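(* Let $\mathrm{U}$ be a countable homogeneous relational structure whose age is a free amalgamation class. If $\mathrm{U}$ is not rank linear, then $\mathrm{U}$ is divisible (i.e., not indivisible).
   Context: Relational languages have no $0$-ary symbols, and relations hold only on tuples of pairwise distinct elements. Embeddings are injections preserving and reflecting all relations; the age of a structure is the class of finite structures embeddable into it; $\mathrm{U}_{\downarrow S}$ is the induced substructure on $S$. $\mathrm{U}$ is homogeneous if every isomorphism between finite induced substructures extends to an automorphism. Two distinct elements $a,b$ of $F$ are Gaifman-adjacent in $F$ if some relation holds on a tuple with all entries in $F$ containing both. The free amalgam of structures on $B\cup C$ and $B\cup C'$ ($B,C,C'$ pairwise disjoint) agreeing on $B$ is the structure on $B\cup C\cup C'$ restricting to both in which no element of $C$ is Gaifman-adjacent to an element of $C'$; a free amalgamation class is a class of finite structures closed under induced substructures and free amalgams. With $\mathrm{G}$ the automorphism group and $\mathrm{G}_F$ pointwise stabilizers: a type is $\langle F\mid x\rangle$ with $F$ finite, $x\notin F$; its typeset is $\{g(x):g\in\mathrm{G}_F\}$, and its rank is the age of the induced substructure on its typeset. $\mathrm{U}$ is rank linear if the ranks of all its types are linearly ordered by inclusion. $\mathrm{U}$ is indivisible if for every $c:U\to 2$ there is an embedding $f:\mathrm{U}\to\mathrm{U}$ with $c$ constant on $f[U]$. *)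

(* Defs.v *)
From mathcomp Require Import all_boot.
From mathcomp Require Import boolp classical_sets functions cardinality.

Set Implicit Arguments.
Unset Strict Implicit.
Unset Printing Implicit Defensive.

Local Open Scope classical_set_scope.

(* No finiteness or countability is imposed on the set of relation symbols. *)
Record language := Language {
  symbol : Type;
  arity : symbol -> nat;
  arity_gt0 : forall r, 0 < arity r }.

Record structure (L : language) (T : Type) := Structure {
  holds : forall r : symbol L, ('I_(arity r) -> T) -> Prop;
  holds_inj : forall r t, @holds r t -> injective t }.

Section Morphisms.
Variable L : language.

Definition embedding T T' (A : structure L T) (B : structure L T')
    (f : T -> T') : Prop :=
  injective f /\ forall r t, holds A (r := r) t <-> holds B (f \o t).

Definition isomorphism T T' (A : structure L T) (B : structure L T')
    (f : T -> T') : Prop :=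
  embedding A B f /\ bijective f.

Definition automorphism T (U : structure L T) (g : T -> T) : Prop :=
  isomorphism U U g.

Section Induced.
Variables (T : Type) (U : structure L T) (S : set T).

Definition induced_holds (r : symbol L) (t : 'I_(arity r) -> S) : Prop :=
  holds U (val \o t).

Lemma induced_holds_inj r t : @induced_holds r t -> injective t.
Proof. by move=> /holds_inj; apply: inj_compr. Qed.

Definition induced : structure L S := Structure induced_holds_inj.
End Induced.

End Morphisms.

Section Classes.
Variable L : language.

Definition structure_class := forall T : Type, structure L T -> Prop.

Definition subclass (K K' : structure_class) : Prop :=
  forall T (A : structure L T), K T A -> K' T A.

Definition age T (U : structure L T) : structure_class :=
  fun T' A => finite_set [set: T'] /\ exists f : T' -> T, embedding A U f.

Definition gaifman_adjacent T (A : structure L T) (a b : T) : Prop :=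
  a <> b /\ exists (r : symbol L) (t : 'I_(arity r) -> T),
    [/\ holds A t, exists i, t i = a & exists j, t j = b].

(* Disjoint unions of sets are rendered as sum types: B + C + C' carries the
   amalgam, and [amalgam_l], [amalgam_r] are the inclusions of B + C and of
   B + C' in it. *)
Definition amalgam_l (B C C' : Type) (x : B + C) : B + C + C' := inl x.

Definition amalgam_r (B C C' : Type) (x : B + C') : B + C + C' :=
  match x with inl b => inl (inl b) | inr c' => inr c' end.

Definition agree_on_base (B C C' : Type)
    (X : structure L (B + C)) (Y : structure L (B + C')) : Prop :=
  forall (r : symbol L) (t : 'I_(arity r) -> B),
    holds X (inl \o t) <-> holds Y (inl \o t).

Definition is_free_amalgam (B C C' : Type)
    (X : structure L (B + C)) (Y : structure L (B + C'))
    (D : structure L (B + C + C')) : Prop :=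
  [/\ embedding X D (@amalgam_l B C C'),
      embedding Y D (@amalgam_r B C C') &
      forall (c : C) (c' : C'), ~ gaifman_adjacent D (inl (inr c)) (inr c')].

Definition free_amalgamation_class (K : structure_class) : Prop :=
  [/\ forall T (A : structure L T), K T A -> finite_set [set: T],
      forall T (A : structure L T) (S : set T), K T A -> K S (induced A S) &
      forall (B C C' : Type) (X : structure L (B + C))
        (Y : structure L (B + C')) (D : structure L (B + C + C')),
        K _ X -> K _ Y -> agree_on_base X Y -> is_free_amalgam X Y D -> K _ D].

End Classes.

Section Properties.
Variables (L : language) (T : Type) (U : structure L T).

Definition homogeneous : Prop :=
  forall F F' : set T, finite_set F -> finite_set F' ->
  forall f : F -> F', isomorphism (induced U F) (induced U F') f ->
  exists g : T -> T, automorphism U g /\ forall x : F, g (val x) = val (f x).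

Definition stabilizer (F : set T) : set (T -> T) :=
  [set g | automorphism U g /\ forall z, F z -> g z = z].

Definition is_type (F : set T) (x : T) : Prop := finite_set F /\ ~ F x.

Definition typeset (F : set T) (x : T) : set T :=
  [set g x | g in stabilizer F].

Definition rank (F : set T) (x : T) : structure_class L :=
  age (induced U (typeset F x)).

Definition rank_linear : Prop :=
  forall F x F' x', is_type F x -> is_type F' x' ->
    subclass (rank F x) (rank F' x') \/ subclass (rank F' x') (rank F x).

Definition indivisible : Prop :=
  forall c : T -> bool,
  exists f : T -> T, embedding U U f /\ exists b, forall x, c (f x) = b.

End Properties.

(* Main.v *)
Require Import Defs.
From mathcomp Require Import all_boot.
From mathcomp Require Import boolp classical_sets functions cardinality.

(* If <F|x> and <F'|x'> have incomparable ranks, list all copies of the two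
   typesets under automorphisms (a copy is determined by the image of F or F',
   so there are countably many) and colour a point according to whether the
   first copy containing it comes from <F|x> or from <F'|x'>.  An embedding f
   into one colour class, say that of <F|x>, maps the typeset of <F'|x'> into
   one copy in the list, hence into the union of the finitely many preceding
   copies of the typeset of <F|x>.  The contradiction is a vertex Ramsey
   property: in every finite colouring of a typeset, each of its finite subsets
   has a monochromatic translate under the stabilizer.  A rank need not be a
   free amalgamation class, but the Ramsey property only needs amalgams over
   F together with points of the typeset that are pairwise not adjacent over F,
   and any bijection between two sets of such points extends to the
   stabilizer. *)

Set Implicit Arguments.
Unset Strict Implicit.
Unset Printing Implicit Defensive.

Local Open Scope classical_set_scope.

(** * Automorphisms, pointwise stabilizers, typesets, and extension by homogeneity *)

Section Automorphisms.
Variables (L : language) (T : Type) (U : structure L T).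
Implicit Types (g h : T -> T) (F : set T).

Lemma automorphism_id : automorphism U id.
Proof. by split; [split | exists id]. Qed.

Lemma automorphism_holds g (r : symbol L) (t : 'I_(arity r) -> T) :
  automorphism U g -> holds U (g \o t) <-> holds U t.
Proof. by move=> [[_ gH] _]; rewrite -gH. Qed.

Lemma automorphism_comp g h :
  automorphism U g -> automorphism U h -> automorphism U (g \o h).
Proof.
move=> [[gI gH] gB] [[hI hH] hB]; split; last exact: bij_comp.
by split=> [|r t]; [exact: inj_comp | rewrite hH gH].
Qed.

Lemma automorphism_inv g : automorphism U g ->
  exists h, [/\ automorphism U h, cancel g h & cancel h g].
Proof.
move=> [[gI gH] [h gK hK]]; exists h; split=> //.
split; last by exists g.
split=> [|r t]; first exact: can_inj hK.
rewrite [X in _ <-> X]gH; suff -> : g \o (h \o t) = t by [].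
by apply: funext => i /=.
Qed.

Lemma stabilizer_id F : stabilizer U F id.
Proof. by split=> //; exact: automorphism_id. Qed.

Lemma stabilizer_comp F g h :
  stabilizer U F g -> stabilizer U F h -> stabilizer U F (g \o h).
Proof.
move=> [ga gF] [ha hF]; split; first exact: automorphism_comp.
by move=> z Fz /=; rewrite hF // gF.
Qed.

Lemma stabilizer_inv F g : stabilizer U F g ->
  exists h, [/\ stabilizer U F h, cancel g h & cancel h g].
Proof.
move=> [/automorphism_inv[h [ha gK hK]] gF]; exists h; split=> //.
by split=> // z Fz; rewrite -[in LHS](gF z Fz) gK.
Qed.

Lemma typeset_stable F x g z :
  stabilizer U F g -> typeset U F x z -> typeset U F x (g z).
Proof. by move=> gF [h hF <-]; exists (g \o h) => //; exact: stabilizer_comp. Qed.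

Lemma typeset_trans F x y z : typeset U F x y -> typeset U F x z ->
  exists2 h, stabilizer U F h & h y = z.
Proof.
move=> [h1 h1F <-] [h2 h2F <-].
have [h1' [h1'F h1K _]] := stabilizer_inv h1F.
by exists (h2 \o h1'); [exact: stabilizer_comp | rewrite /= h1K].
Qed.

Lemma typeset_disjoint F x z : ~ F x -> typeset U F x z -> ~ F z.
Proof.
move=> nFx [h [[[hI _] _] hF] <-] Fhx; apply: nFx.
by rewrite -(hI _ _ (hF _ Fhx)).
Qed.

Lemma extend_partial_isomorphism (S : set T) (f : T -> T) :
  homogeneous U -> finite_set S -> set_inj S f ->
  (forall r (t : 'I_(arity r) -> T), (forall i, S (t i)) ->
    holds U t <-> holds U (f \o t)) ->
  exists g, automorphism U g /\ forall a, S a -> g a = f a.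
Proof.
move=> homU finS fI fH.
have fS (z : S) : f (val z) \in f @` S by apply/mem_set/imageP/set_mem/valP.
pose f' (z : S) : f @` S := exist _ (f (val z)) (fS z).
have f'I : injective f'.
  move=> y z /(congr1 val) /= /fI e; apply: val_inj.
  by apply: e; apply/valP.
have f'S (y : f @` S) : exists z, f' z = y.
  have /set_mem[z Sz fz] := valP y.
  by exists (exist _ z (mem_set Sz)); apply: val_inj.
have [f'' f''P] := choice f'S.
have f'iso : isomorphism (induced U S) (induced U (f @` S)) f'.
  split; last by exists f'' => // z; apply: f'I.
  split=> // r t; rewrite /= /induced_holds.
  rewrite fH => [|i]; first by [].
  exact/set_mem/(valP (t i)).
have [g [ga gP]] := homU _ _ finS (finite_image f finS) f' f'iso.
exists g; split=> // a Sa.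
by have := gP (exist _ a (mem_set Sa)).
Qed.

Lemma extend_isomorphic_embeddings (I : Type) (e e' : I -> T) :
  homogeneous U -> finite_set [set: I] -> injective e -> injective e' ->
  (forall r (t : 'I_(arity r) -> I), holds U (e \o t) <-> holds U (e' \o t)) ->
  exists g, automorphism U g /\ forall i, g (e i) = e' i.
Proof.
move=> homU finI eI e'I ee'.
have [|f fe] := @choice T T (fun x y => forall i, e i = x -> y = e' i).
  move=> x; have [[i ix]|nx] := pselect (exists i, e i = x).
    by exists (e' i) => j jx; congr e'; apply: eI; rewrite ix jx.
  by exists x => i ix; case: nx; exists i.
have feE i : f (e i) = e' i by exact: fe.
have [|||g [ga gP]] := @extend_partial_isomorphism (range e) f homU.
- exact: finite_image.
- by move=> _ _ /set_mem[i _ <-] /set_mem[j _ <-]; rewrite !feE => /e'I ->.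
- move=> r t te; have /choice[u ut] : forall k, exists i, e i = t k.
    by move=> k; have [i _ ti] := te k; exists i.
  have -> : t = e \o u by apply: funext => k /=.
  rewrite ee'; suff -> : f \o (e \o u) = e' \o u by [].
  by apply: funext => k /=.
by exists g; split=> // i; rewrite gP ?feE //; exists i.
Qed.

End Automorphisms.

(** * Free amalgams and their realisation inside [U] *)

Section FreeExtension.
Variables (L : language) (T : Type) (U : structure L T).

Section Pullback.
Variables (T' : Type) (A : structure L T) (f : T' -> T).

Definition pullback_holds (r : symbol L) (t : 'I_(arity r) -> T') : Prop :=
  holds A (f \o t).

Lemma pullback_holds_inj r t : @pullback_holds r t -> injective t.
Proof. by move=> /holds_inj; apply: inj_compr. Qed.

Definition pullback : structure L T' := Structure pullback_holds_inj.


End Pullback.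

Section Amalgam.
Variables (B C C' : Type) (X : structure L (B + C)) (Y : structure L (B + C')).

Definition amalgam_holds (r : symbol L) (t : 'I_(arity r) -> B + C + C') :=
  (exists2 u, t = @amalgam_l B C C' \o u & holds X u) \/
  (exists2 u, t = @amalgam_r B C C' \o u & holds Y u).

Lemma amalgam_l_inj : injective (@amalgam_l B C C').
Proof. by move=> x y []. Qed.

Lemma amalgam_r_inj : injective (@amalgam_r B C C').
Proof. by move=> [x|x] [y|y] // []->. Qed.

Lemma amalgam_holds_inj r t : @amalgam_holds r t -> injective t.
Proof.
case=> -[u -> /holds_inj uI].
- exact: inj_comp amalgam_l_inj uI.
- exact: inj_comp amalgam_r_inj uI.
Qed.

Definition free_amalgam := Structure amalgam_holds_inj.

(** A tuple lying on both sides lies in the base; where the two structures agree there, neither side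
    gains relations in the amalgam. *)
Lemma common_base (r : symbol L) (u : 'I_(arity r) -> B + C) (v : 'I_(arity r) -> B + C') :
  @amalgam_l B C C' \o u = @amalgam_r B C C' \o v ->
  exists w : 'I_(arity r) -> B, u = inl \o w /\ v = inl \o w.
Proof.
move=> uv.
have /choice[w wP] : forall i, exists b : B, u i = inl b /\ v i = inl b.
  move=> i; have := congr1 (@^~ i) uv; rewrite /amalgam_l /amalgam_r /=.
  by case: (v i) => [b|c] // [->]; exists b.
by exists w; split; apply: funext => i /=; case: (wP i).
Qed.

Lemma free_amalgamP : agree_on_base X Y -> is_free_amalgam X Y free_amalgam.
Proof.
move=> XY; split.
- split=> [|r t]; first exact: amalgam_l_inj.
  split=> [Xt|]; first by left; exists t.
  case=> -[u].
    move=> tu Xu.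
    suff -> : t = u by [].
    apply: funext => i; apply: amalgam_l_inj.
    exact: (congr1 (@^~ i) tu).
  by move=> /common_base[w [-> ->]] /XY.
- split=> [|r t]; first exact: amalgam_r_inj.
  split=> [Yt|]; first by right; exists t.
  case=> -[u].
    by move=> /esym/common_base[w [-> ->]] /XY.
  move=> tu Xu.
  suff -> : t = u by [].
  apply: funext => i; apply: amalgam_r_inj.
  exact: (congr1 (@^~ i) tu).
- move=> c c' [_ [r [t [[[u -> _]|[u -> _]] [i /= ti] [j /= tj]]]]].
    by move: tj.
  by move: ti; case: (u i).
Qed.

End Amalgam.

(* Gaifman adjacency in the induced substructure on [X], for distinct [a, b]. *)
Definition linked (X : set T) (a b : T) : Prop :=
  exists r (t : 'I_(arity r) -> T),
    [/\ holds U t, forall i, X (t i), exists i, t i = a & exists j, t j = b].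

Lemma linked_automorphism g X Y a b : automorphism U g ->
  (forall z, Y (g z) -> X z) -> linked Y (g a) (g b) -> linked X a b.
Proof.
move=> ga YX [r [t [Ut tY [i ti] [j tj]]]].
have [h [ha gK hK]] := automorphism_inv ga.
exists r, (h \o t); split.
- exact/(automorphism_holds _ ha).
- by move=> k; apply: YX; rewrite /= hK.
- by exists i; rewrite /= ti gK.
- by exists j; rewrite /= tj gK.
Qed.

Lemma finite_setT_inj (T' : Type) (X : set T) (f : T' -> T) :
  injective f -> finite_set X -> (forall z, X (f z)) -> finite_set [set: T'].
Proof.
move=> fI finX fX.
have -> : [set: T'] = f @^-1` X by apply/seteqP; split=> z _ //; exact: fX.
by apply: finite_preimage => // y z _ _; exact: fI.
Qed.

Hypotheses (homU : homogeneous U) (freeU : free_amalgamation_class (age U)).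

(** The free amalgam of [X] and [Y] over [Z] belongs to the age, so it embeds in [U]. Homogeneity
    carries the side of [X] back onto [X] itself, and the other side becomes the translate of
    [Y]. *)
Lemma free_extension (X Y Z : set T) :
  finite_set X -> finite_set Y -> Z `<=` X -> Z `<=` Y ->
  exists g, [/\ stabilizer U Z g,
    forall y, Y y -> ~ Z y -> ~ X (g y) &
    forall x y, X x -> ~ Z x -> Y y -> ~ Z y ->
      ~ linked (X `|` g @` Y) x (g y)].
Proof.
move=> finX finY ZX ZY.
pose B : Type := Z; pose C : Type := X `\` Z; pose C' : Type := Y `\` Z.
pose l (z : B + C) : T := match z with inl b => val b | inr c => val c end.
pose r (z : B + C') : T := match z with inl b => val b | inr c => val c end.
have BZ (b : B) : Z (val b) by exact/set_mem/valP.
have CX (c : C) : (X `\` Z) (val c) by exact/set_mem/valP.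
have CY (c : C') : (Y `\` Z) (val c) by exact/set_mem/valP.
have lI : injective l.
  move=> [x|x] [y|y] /= e.
  - by congr inl; exact: val_inj.
  - by case: (CX y) => _ []; rewrite -[\val y]e; exact: BZ.
  - by case: (CX x) => _ []; rewrite [\val x]e; exact: BZ.
  - by congr inr; exact: val_inj.
have rI : injective r.
  move=> [x|x] [y|y] /= e.
  - by congr inl; exact: val_inj.
  - by case: (CY y) => _ []; rewrite -[\val y]e; exact: BZ.
  - by case: (CY x) => _ []; rewrite [\val x]e; exact: BZ.
  - by congr inr; exact: val_inj.
have lX z : X (l z) by case: z => [b|c] /=; [exact: ZX (BZ b) | case: (CX c)].
have rY z : Y (r z) by case: z => [b|c] /=; [exact: ZY (BZ b) | case: (CY c)].
have lE x : X x -> exists z, l z = x.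
  move=> Xx; have [Zx|nZx] := pselect (Z x).
    by exists (inl (exist _ x (mem_set Zx))).
  by exists (inr (exist _ x (mem_set (conj Xx nZx)))).
have rE y : Y y -> exists z, r z = y.
  move=> Yy; have [Zy|nZy] := pselect (Z y).
    by exists (inl (exist _ y (mem_set Zy))).
  by exists (inr (exist _ y (mem_set (conj Yy nZy)))).
have lE' x : X x -> ~ Z x -> exists c, l (inr c) = x.
  by move=> Xx nZx; exists (exist _ x (mem_set (conj Xx nZx))).
have rE' y : Y y -> ~ Z y -> exists c, r (inr c) = y.
  by move=> Yy nZy; exists (exist _ y (mem_set (conj Yy nZy))).
pose Xs := pullback U l; pose Ys := pullback U r.
have ageX : age U Xs.
  by split; [exact: finite_setT_inj lI finX lX | exists l].
have ageY : age U Ys.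
  by split; [exact: finite_setT_inj rI finY rY | exists r].
have agr : agree_on_base Xs Ys by [].
have Dam := free_amalgamP agr.
have [_ _ /(_ _ _ _ _ _ _ ageX ageY agr Dam) [_ [e [eI eH]]]] := freeU.
have [[_ lH] [_ rH] nadj] := Dam.
(* [k] and [k'] send [X] and [Y] onto the two sides of the embedded amalgam; undoing [k] after [k']
   gives the required automorphism. *)
have [k [ka kl]] : exists g, automorphism U g /\
    forall z, g (l z) = e (@amalgam_l B C C' z).
  apply: extend_isomorphic_embeddings => //.
  - exact: finite_setT_inj lI finX lX.
  - exact: inj_comp eI (@amalgam_l_inj B C C').
  - by move=> s t; rewrite -[holds U (l \o t)]/(holds Xs t) lH eH.
have [k' [ka' kr]] : exists g, automorphism U g /\
    forall z, g (r z) = e (@amalgam_r B C C' z).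
  apply: extend_isomorphic_embeddings => //.
  - exact: finite_setT_inj rI finY rY.
  - exact: inj_comp eI (@amalgam_r_inj B C C').
  - by move=> s t; rewrite -[holds U (r \o t)]/(holds Ys t) rH eH.
have [h [ha kK hK]] := automorphism_inv ka.
exists (h \o k'); split.
- split; first exact: automorphism_comp.
  move=> z Zz; pose b : B := exist _ z (mem_set Zz).
  by have := kr (inl b); have := kl (inl b); rewrite /= => <- ->.
- move=> y Yy nZy /lE[z zy].
  have [c cy] := rE' y Yy nZy.
  move: zy; rewrite /= -cy kr => /(congr1 k); rewrite hK kl => /eI.
  by case: z.
move=> x y Xx nZx Yy nZy [s [t [Ut tXY [i ti] [j tj]]]].
have [c xE] := lE' x Xx nZx; have [c' yE] := rE' y Yy nZy.
have /choice[w wP] : forall i, exists z, e z = k (t i).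
  move=> n; have [/lE[z <-]|[z /rE[z' <-] <-]] := tXY n.
    by rewrite kl; eexists.
  by rewrite /= hK kr; eexists.
have ew : e \o w = k \o t by apply: funext => n /=.
apply: (nadj c c'); split=> //; exists s, w; split.
- by apply/eH; rewrite ew; apply/(automorphism_holds _ ka).
- by exists i; apply: eI; rewrite wP ti -xE kl.
- by exists j; apply: eI; rewrite wP tj /= hK -yE kr.
Qed.

End FreeExtension.

(** * Partite systems inside a typeset *)

Section PartiteSystems.
Variables (L : language) (T : choiceType) (U : structure L T).
Hypotheses (homU : homogeneous U) (freeU : free_amalgamation_class (age U)).
Variables (F : set T) (x : T) (finF : finite_set F) (nFx : ~ F x).

(** The parts are the fibres of [p]. Their independence over [F] is what lets injections from one
    part into another independent set extend to the stabilizer. *)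
Definition partite (V : set T) (p : T -> nat) : Prop :=
  [/\ finite_set V, V `<=` typeset U F x &
    forall a b, V a -> V b -> a <> b -> p a = p b -> ~ linked U (F `|` V) a b].

Lemma stabilizer_reflects g z : stabilizer U F g -> F (g z) -> F z.
Proof. by move=> [[[gI _] _] gF] Fz; rewrite -(gI _ _ (gF _ Fz)). Qed.

(** The copy of [V] is amalgamated freely with [X] over [F] and the image of [A] under [g0]. No
    relation holds on a tuple with entries outside this base on both sides, so independence can be
    checked in [X] and in the copy separately. *)
Lemma partite_glue (X V A : set T) (q p : T -> nat) (g0 : T -> T) :
  partite X q -> partite V p -> A `<=` V -> stabilizer U F g0 ->
  (forall a, A a -> X (g0 a) /\ q (g0 a) = p a) ->
  exists g q', [/\ stabilizer U F g, forall a, A a -> g a = g0 a,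
    forall v, V v -> ~ A v -> ~ X (g v), forall z, X z -> q' z = q z &
    forall v, V v -> q' (g v) = p v] /\ partite (X `|` g @` V) q'.
Proof.
move=> [finX XS Xq] [finV VS Vp] AV g0F g0A.
have nSF z : typeset U F x z -> ~ F z by exact: typeset_disjoint.
have g0I : injective g0 by case: g0F => -[[]].
pose Z := F `|` g0 @` A.
have [|||| g1 [g1Z g1X nl]] := @free_extension _ _ _ homU freeU
  (F `|` X) (F `|` g0 @` V) Z.
- by rewrite finite_setU.
- by rewrite finite_setU; split=> //; exact: finite_image.
- by move=> z [Fz|[a /g0A[Xa _] <-]]; [left | right].
- by move=> z [Fz|[a /AV Va <-]]; [left | right; exists a].
have g0Z v : V v -> ~ A v -> ~ Z (g0 v).
  move=> Vv nAv [Fv|[a Aa /g0I av]]; last by rewrite -av in nAv.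
  by apply: nSF Fv; apply: typeset_stable => //; exact: VS.
pose g := g1 \o g0.
have gF : stabilizer U F g.
  apply: stabilizer_comp g0F; case: g1Z => ga gZ; split=> // z Fz.
  by apply: gZ; left.
have gI : injective g by case: gF => -[[]].
have gA a : A a -> g a = g0 a.
  by move=> Aa; rewrite /g /= (proj2 g1Z) //; right; exists a.
have gX v : V v -> ~ A v -> ~ X (g v).
  move=> Vv nAv Xv; apply: (g1X (g0 v)); last by right.
  - by right; exists v.
  - exact: g0Z.
have gS z : typeset U F x z -> typeset U F x (g z) by exact: typeset_stable.
have [h [_ gK _]] := stabilizer_inv gF.
(* Outside [X] a point of the copy takes the part of its preimage; on common points, all coming from
   [A], the two rules agree by hypothesis. *)
pose q' z := if pselect (X z) then q z else p (h z).
have q'X z : X z -> q' z = q z by rewrite /q'; case: pselect.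
have q'V v : V v -> q' (g v) = p v.
  move=> Vv; rewrite /q'; case: pselect => /= [Xv|_]; last by rewrite gK.
  have [Av|nAv] := pselect (A v); last by case: (gX v).
  by rewrite gA //; case: (g0A v Av).
exists g, q'; split; first by split.
have YS z : (X `|` g @` V) z -> typeset U F x z.
  by move=> [/XS//|[v /VS Sv <-]]; exact: gS.
split=> //; first by rewrite finite_setU; split=> //; exact: finite_image.
move=> a b Ya Yb ab pab [r [t [Ut tY [i ti] [j tj]]]].
have nFa : ~ F a by exact/nSF/YS.
have nFb : ~ F b by exact/nSF/YS.
have [tX|/existsNP[k nXk]] := pselect (forall k, (F `|` X) (t k)).
  have Xa : X a by case: (tX i); rewrite ti.
  have Xb : X b by case: (tX j); rewrite tj.
  apply: (Xq a b) => //; first by rewrite -q'X // pab q'X.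
  by exists r, t; split=> //; [exists i | exists j].
have [tV|/existsNP[k' nVk']] := pselect (forall k, (F `|` g @` V) (t k)).
  have [v Vv va] : (g @` V) a by case: (tV i); rewrite ti.
  have [w Vw wb] : (g @` V) b by case: (tV j); rewrite tj.
  apply: (Vp v w) => //.
  - by move=> vw; apply: ab; rewrite -va -wb vw.
  - by rewrite -q'V // va pab -wb q'V.
  apply: (linked_automorphism (g := g) (Y := F `|` g @` V)).
  - by case: gF.
  - move=> z [/(stabilizer_reflects gF)|[u Vu /gI <-]]; [by left | by right].
  - by exists r, t; split=> //; [exists i; rewrite va | exists j; rewrite wb].
have Xk' : X (t k').
  by have [Fk'|[]] := tY k' => // [|Vk']; case: nVk'; [left | right].
have [v Vv vk] : (g @` V) (t k).
  by have [Fk|[Xk|]] := tY k => //; case: nXk; [left | right].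
apply: (nl (t k') (g0 v)).
- by right.
- move=> [Fk'|[a' Aa' ak']]; apply: nVk'; first by left.
  by right; exists a'; [exact: AV | rewrite gA].
- by right; exists v.
- apply: g0Z => // Av; apply: nXk; right; rewrite -vk gA //.
  by case: (g0A v Av).
exists r, t; split=> //; last by exists k.
  move=> n; have [Fn|[Xn|[u Vu <-]]] := tY n; [by left; left | by left; right |].
  by right; exists (g0 u) => //; right; exists u.
by exists k'.
Qed.

(** The base images of [A] and the copies already present survive, because each gluing only enlarges
    the system and preserves the part function. *)
Lemma partite_glue_seq (I : eqType) (s : seq I) (X V A : set T) (q : T -> nat)
    (p : I -> T -> nat) (g0 : I -> T -> T) :
  partite X q -> (forall i, i \in s -> partite V (p i)) -> A `<=` V ->
  (forall i, i \in s -> stabilizer U F (g0 i)) ->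
  (forall i a, i \in s -> A a -> X (g0 i a) /\ q (g0 i a) = p i a) ->
  exists Y q', [/\ X `<=` Y, forall z, X z -> q' z = q z, partite Y q' &
    forall i, i \in s -> exists g, [/\ stabilizer U F g,
      forall a, A a -> g a = g0 i a &
      forall v, V v -> Y (g v) /\ q' (g v) = p i v]].
Proof.
move=> Xq Vp AV g0F g0A; elim: s => [|i s IHs] in Vp g0F g0A *.
  by exists X, q; split.
have sub j : j \in s -> j \in i :: s by rewrite inE orbC => ->.
have [|||Y [q' [XY q'X Yq' IHi]]] := IHs.
- by move=> j /sub; exact: Vp.
- by move=> j /sub; exact: g0F.
- by move=> j a /sub; exact: g0A.
have is_ : i \in i :: s by exact: mem_head.
have [|g [q'' [[gF gA _ q''Y q''V] Yq'']]] :=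
    partite_glue Yq' (Vp i is_) AV (g0F i is_).
  move=> a Aa; have [Xa <-] := g0A i a is_ Aa.
  by split; [exact: XY | exact: q'X].
exists (Y `|` g @` V), q''; split=> //.
- by move=> z /XY; left.
- by move=> z Xz; rewrite q''Y ?q'X //; exact: XY.
move=> j; rewrite inE => /predU1P[->|/IHi[h [hF hA hV]]].
  exists g; split=> // v Vv; split; [by right; exists v | exact: q''V].
exists h; split=> // v Vv; have [Yv q'v] := hV v Vv.
by split; [left | rewrite q''Y].
Qed.

(** Points are added one by one, each a translate of [x] glued over [F] alone. *)
Lemma large_part (i K : nat) :
  exists w : seq T, [/\ uniq w, size w = K & partite [set` w] (fun=> i)].
Proof.
elim: K => [|K [w [uw sw wi]]].
  by exists [::]; split=> //; split.
have xi : partite [set x] (fun=> i).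
  split; first exact: finite_set1.
    by move=> _ ->; exists id => //; exact: stabilizer_id.
  by move=> a b -> ->.
have noa a : set0 a -> [set` w] (id a) /\ i = i by [].
have [g [q [[gF _ gw qw qg] wgq]]] :=
  partite_glue wi xi (@sub0set _ [set x]) (stabilizer_id U F) noa.
exists (g x :: w); split=> /=; last 1 first.
- have -> : [set` g x :: w] = [set` w] `|` g @` [set x].
    rewrite image_set1; apply/seteqP; split=> z /=.
      by rewrite inE => /predU1P[->|]; [right | left].
    by rewrite inE => -[->|->]; rewrite ?eqxx ?orbT.
  case: wgq => finw wS indep; split=> // a b wa wb ab _.
  apply: indep => //.
  have qi z : ([set` w] `|` g @` [set x]) z -> q z = i.
    by move=> [/qw //|[y -> <-]]; rewrite qg.
  by rewrite !qi.
- rewrite uw andbT; apply/negP => /gw; exact.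
- by rewrite sw.
Qed.

(** Tuples with at most one entry in [W] are preserved, since all points of the typeset have the
    same type over [F]; tuples with two entries in [W] hold on neither side, by independence.
    Homogeneity then applies. *)
Lemma independent_bijection (W W' : set T) (phi : T -> T) :
  finite_set W -> W `<=` typeset U F x -> W' `<=` typeset U F x ->
  (forall a b, W a -> W b -> a <> b -> ~ linked U (F `|` W) a b) ->
  (forall a b, W' a -> W' b -> a <> b -> ~ linked U (F `|` W') a b) ->
  {in W &, injective phi} -> (forall a, W a -> W' (phi a)) ->
  exists g, stabilizer U F g /\ forall a, W a -> g a = phi a.
Proof.
move=> finW WS W'S Wi W'i phiI phiW.
have nWF z : W z -> ~ F z by move=> /WS; exact: typeset_disjoint.
have nW'F z : W' z -> ~ F z by move=> /W'S; exact: typeset_disjoint.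
pose psi z := if pselect (F z) then z else phi z.
have psiF z : F z -> psi z = z by rewrite /psi; case: pselect.
have psiW z : W z -> psi z = phi z.
  by move=> /nWF nFz; rewrite /psi; case: pselect.
have [|||g [ga gP]] := @extend_partial_isomorphism _ _ U (F `|` W) psi homU.
- by rewrite finite_setU.
- move=> a b /set_mem[Fa|Wa] /set_mem[Fb|Wb].
  + by rewrite !psiF.
  + rewrite psiF // psiW // => ab; case: (nW'F (phi b)); first exact: phiW.
    by rewrite -ab.
  + rewrite psiW // psiF // => ab; case: (nW'F (phi a)); first exact: phiW.
    by rewrite ab.
  + by rewrite !psiW // => /phiI; apply; exact: mem_set.
- move=> r t tFW.
  have [one|/existsNP[i /existsNP[j]]] :=
      pselect (forall i j, W (t i) -> W (t j) -> t i = t j).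
    have [h [hF ht]] : exists h, stabilizer U F h /\ psi \o t = h \o t.
      have [[i Wi']|noW] := pselect (exists i, W (t i)); last first.
        exists id; split; first exact: stabilizer_id.
        apply: funext => i /=; rewrite psiF //.
        by have [|Wi'] := tFW i => //; case: noW; exists i.
      have [h hF hti] := typeset_trans (WS _ Wi') (W'S _ (phiW _ Wi')).
      exists h; split=> //; apply: funext => j /=.
      have [Fj|Wj] := tFW j; first by rewrite psiF // (proj2 hF).
      by rewrite psiW // (one j i) // hti.
    by rewrite ht; apply: iff_sym; apply: automorphism_holds; case: hF.
  move=> /not_implyP[Wti /not_implyP[Wtj tij]]; split=> Ut.
    case: (Wi (t i) (t j)) => //.
    by exists r, t; split=> //; [exists i | exists j].
  case: (W'i (phi (t i)) (phi (t j))); try exact: phiW.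
    by move=> /phiI tij'; apply: tij; apply: tij'; exact: mem_set.
  exists r, (psi \o t); split=> //.
  + move=> k /=; have [Fk|Wk] := tFW k; first by left; rewrite psiF.
    by right; rewrite psiW //; exact: phiW.
  + by exists i; rewrite /= psiW.
  + by exists j; rewrite /= psiW.
exists g; split; last by move=> a Wa; rewrite gP ?psiW //; right.
by split=> // z Fz; rewrite gP ?psiF //; left.
Qed.

(** Pigeonhole: some colour occurs at least [m] times, and [e] enumerates [m] of its indices. *)
Lemma monochromatic_injection (n m : nat) (col : 'I_(n.+1 * m) -> 'I_n.+1) :
  exists (e : {ffun 'I_m -> 'I_(n.+1 * m)}) d,
    injectiveb e /\ forall j, col (e j) = d.
Proof.
have [d md] : exists d, m <= #|[set j | col j == d]%SET|.
  apply: contrapT => /forallNP small.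
  have : \sum_(d < n.+1) #|[set j | col j == d]%SET| = n.+1 * m.
    rewrite -[RHS]card_ord -sum1_card (partition_big col predT) //=.
    by apply: eq_bigr => d _; rewrite -sum1_card; apply: eq_bigl => j; rewrite inE.
  have sum_lt (N : 'I_n.+1 -> nat) :
      (forall d, N d < m) -> \sum_(d < n.+1) N d < n.+1 * m.
    move=> Nm; rewrite big_ord_recl mulSn -addSn; apply: leq_add => //.
    rewrite -[X in _ <= X * _]card_ord -sum_nat_const; apply: leq_sum => d _.
    exact: ltnW.
  move=> sumE; have := sum_lt (fun d => #|[set j | col j == d]%SET|).
  rewrite sumE ltnn => absurd; suff: false by []; apply: absurd => d; rewrite ltnNge; exact/negP/small.
pose e : {ffun 'I_m -> 'I_(n.+1 * m)} :=
  [ffun j => enum_val (widen_ord md j)].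
exists e, d; split.
  apply/injectiveP => i j; rewrite !ffunE => /enum_val_inj /(congr1 val) /= ij.
  exact: val_inj.
move=> j; rewrite ffunE.
by have := enum_valP (widen_ord md j); rewrite inE => /eqP.
Qed.

(** * The vertex Ramsey property of a typeset *)

Section Coloring.
Variables (n : nat) (c : T -> 'I_n.+1).

(* Blow up part [i] to [n.+1] times its size and glue a copy of [V] along every
   injection of part [i] into the result.  The induction hypothesis applied to
   this larger system makes its parts below [i] monochromatic; by pigeonhole one
   of the glued copies then also has a monochromatic part [i]. *)
Lemma monochromatic_parts (i : nat) (V : set T) (p : T -> nat) : partite V p ->
  exists g, stabilizer U F g /\ forall a b, V a -> V b -> p a = p b -> p a < i ->
    c (g a) = c (g b).
Proof.
elim: i V p => [|i IHi] V p Vp; first by exists id; split=> //; exact: stabilizer_id.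
have [finV VS Vindep] := Vp.
pose Vi := [set v | V v /\ p v = i].
have ViV : Vi `<=` V by move=> v [].
have finVi : finite_set Vi by exact: sub_finite_set finV.
have [s0 Vis0] := (proj1 (finite_seqP Vi)) finVi.
pose s := undup s0; pose m := size s.
have sVi v : v \in s <-> Vi v by rewrite mem_undup Vis0.
have [w [uw sw wi]] := large_part i (n.+1 * m).
have [_ wS windep] := wi.
(* [phi e] sends the [j]-th point of part [i] to the point of [w] numbered [e j]; [x] is a default
   outside part [i]. *)
pose phi (e : {ffun 'I_m -> 'I_(n.+1 * m)}) v :=
  if insub (index v s) is Some j then nth x w (e j) else x.
have phiE e v : Vi v -> exists2 j, phi e v = nth x w (e j) & index v s = j.
  move=> /sVi; rewrite -index_mem => js; exists (Ordinal js) => //.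
  by rewrite /phi insubT.
have phiw e v : Vi v -> phi e v \in w.
  by move=> /(phiE e)[j -> _]; rewrite mem_nth // sw.
have /choice[g0 g0P] : forall e : {ffun 'I_m -> 'I_(n.+1 * m)}, exists g,
    injectiveb e -> stabilizer U F g /\ forall v, Vi v -> g v = phi e v.
  move=> e; have [/injectiveP eI|_] := boolP (injectiveb e); last by exists id.
  have [|||||||g gP] := @independent_bijection Vi [set` w] (phi e); last by exists g.
  - by [].
  - by move=> v /ViV/VS.
  - by [].
  - move=> a b [Va pa] [Vb pb] ab [r [t [Ut tV ti tj]]].
    apply: (Vindep a b) => //; first by rewrite pa pb.
    exists r, t; split=> // k.
    by have [Fk|/ViV Vk] := tV k; [left | right].
  - by move=> a b wa wb ab; exact: windep.
  - move=> a b /set_mem Va /set_mem Vb.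
    have [j -> ja] := phiE e a Va; have [k -> kb] := phiE e b Vb.
    move=> /eqP; rewrite nth_uniq ?sw // => /eqP /val_inj /eI jk.
    rewrite -(nth_index x (proj2 (sVi a) Va)) -(nth_index x (proj2 (sVi b) Vb)).
    by rewrite ja kb jk.
  - by move=> a /(phiw e).
pose l := enum [pred e : {ffun 'I_m -> 'I_(n.+1 * m)} | injectiveb e].
have le e : e \in l = injectiveb e by rewrite mem_enum.
have [|||Q [q [wQ qw Qq Qe]]] := @partite_glue_seq _ l [set` w] V Vi (fun=> i)
    (fun=> p) g0 wi _ ViV.
- by [].
- by move=> e; rewrite le => /g0P[].
- move=> e a; rewrite le => /g0P[_ ge] Va; rewrite ge //.
  by split; [exact: phiw | case: Va].
have [g [gF gQ]] := IHi Q q Qq.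
(* [g] controls only the parts below [i], so [w] is coloured through [g] and [e] is chosen with
   monochromatic range. *)
have [e [d [eI ed]]] := @monochromatic_injection n m (fun j => c (g (nth x w j))).
have [|h [hF hVi hV]] := Qe e; first by rewrite le.
exists (g \o h); split; first exact: stabilizer_comp.
move=> a b Va Vb pab; rewrite ltnS leq_eqVlt => /predU1P[pa|pa] /=.
  have Via : Vi a by [].
  have Vib : Vi b by split=> //; rewrite -pab.
  rewrite !hVi // !(proj2 (g0P e eI)) //.
  have [j -> _] := phiE e a Via; have [k -> _] := phiE e b Vib.
  by rewrite (ed j) (ed k).
have [Qa qa] := hV a Va; have [Qb qb] := hV b Vb.
by apply: gQ => //; rewrite qa ?qb.
Qed.

(* The initial system has a transversal copy of [V] for every injection into a
   set of [n.+1 * #|V|] parts. *)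
Lemma monochromatic_copy (V : set T) : finite_set V -> V `<=` typeset U F x ->
  exists g d, stabilizer U F g /\ forall v, V v -> c (g v) = d.
Proof.
move=> /finite_seqP[s0 Vs0] VS.
pose s := undup s0; pose m := size s.
have sV v : v \in s <-> V v by rewrite mem_undup Vs0.
(* For injective [e], distinct points of [V] get distinct parts, so independence is vacuous; [0] is
   a default outside [V]. *)
pose p (e : {ffun 'I_m -> 'I_(n.+1 * m)}) v : nat :=
  if insub (index v s) is Some j then e j else 0.
have pE e v : V v -> exists2 j, p e v = e j & index v s = j.
  move=> /sV; rewrite -index_mem => js; exists (Ordinal js) => //.
  by rewrite /p insubT.
pose l := enum [pred e : {ffun 'I_m -> 'I_(n.+1 * m)} | injectiveb e].
have le e : e \in l = injectiveb e by rewrite mem_enum.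
have [|||||Q [q [_ _ Qq Qe]]] := @partite_glue_seq _ l set0 V set0 (fun=> 0)
    p (fun=> id).
- by split.
- move=> e; rewrite le => /injectiveP eI; split=> //.
    by rewrite Vs0; exact: finite_seq.
  move=> a b Va Vb ab; have [j -> ja] := pE e a Va; have [k -> kb] := pE e b Vb.
  move=> /val_inj /eI jk; case: ab.
  rewrite -(nth_index x (proj2 (sV a) Va)) -(nth_index x (proj2 (sV b) Vb)).
  by rewrite ja kb jk.
- by [].
- by move=> *; exact: stabilizer_id.
- by [].
have [g [gF gQ]] := monochromatic_parts (n.+1 * m) Qq.
(* Each part now has one colour, [ord0] standing in for empty parts; the copy transversal to [m]
   parts of equal colour is monochromatic. *)
have /choice[col colP] : forall j : 'I_(n.+1 * m), exists d,
    forall a, Q a -> q a = j -> c (g a) = d.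
  move=> j; have [[a [Qa qa]]|no] := pselect (exists a, Q a /\ q a = j).
    exists (c (g a)) => b Qb qb; apply: gQ => //; first by rewrite qa qb.
    by rewrite qb.
  by exists ord0 => a Qa qa; case: no; exists a.
have [e [d [eI ed]]] := monochromatic_injection col.
have [|h [hF _ hV]] := Qe e; first by rewrite le.
exists (g \o h), d; split; first exact: stabilizer_comp.
move=> v Vv /=; have [Qv qv] := hV v Vv; have [j pj _] := pE e v Vv.
by rewrite -(ed j); apply: colP => //; rewrite qv.
Qed.

End Coloring.
End PartiteSystems.

(** * Copies of typesets and coverings by finitely many of them *)

Section Copies.
Variables (L : language) (T : countType) (U : structure L T).
Hypothesis homU : homogeneous U.

(** Colour a point of the typeset of [<F'|x'>] by the index of a copy containing its image under
    [f]. The Ramsey property moves any finite [A] in this typeset to a set of one colour; [f]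
    followed by an automorphism then puts [A] into the typeset of [<F|x>], giving the excluded
    inclusion of ranks. *)
Lemma not_covered (F F' : set T) (x x' : T) (f : T -> T) (C : nat -> set T)
    (k : nat) :
  free_amalgamation_class (age U) -> is_type F' x' -> embedding U U f ->
  ~ subclass (rank U F' x') (rank U F x) ->
  (forall i, exists2 h, automorphism U h & C i `<=` h @` typeset U F x) ->
  ~ (forall s, typeset U F' x' s -> exists2 i, i <= k & C i (f s)).
Proof.
move=> freeU [finF' nF'x'] [fI fH] nsub Ccopy cov; apply: nsub.
move=> T' A [finT' [e [eI eH]]]; split=> //.
have /choice[c cP] : forall s, exists i : 'I_k.+1,
    typeset U F' x' s -> C i (f s).
  move=> s; have [/cov[i ik Ci]|?] := pselect (typeset U F' x' s).
    by exists (Ordinal (ik : i < k.+1)).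
  by exists ord0.
have eS t : typeset U F' x' (\val (e t)) by exact/set_mem/valP.
have [||g [d [[ga gF'] gV]]] := @monochromatic_copy _ _ _ homU freeU F' x'
    finF' nF'x' _ c (range (fun t => \val (e t))).
- exact: finite_image.
- by move=> _ [t _ <-].
have [h ha Ch] := Ccopy d.
have [h' [h'a hK h'K]] := automorphism_inv ha.
pose e' t := h' (f (g (\val (e t)))).
have e'S t : e' t \in typeset U F x.
  apply: mem_set; rewrite /e'.
  have /Ch[s Ss <-] : C d (f (g (\val (e t)))).
    rewrite -(gV (\val (e t))); last by exists t.
    by apply: cP; apply: (typeset_stable (conj ga gF')).
  by rewrite hK.
exists (fun t => exist _ (e' t) (e'S t)); split=> [t u /(congr1 val) /= tu|r t].
  apply: eI; apply: val_inj; case: ga => -[gI _] _; apply/gI/fI.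
  by case: h'a => -[h'I _] _; exact: h'I tu.
rewrite eH /= /induced_holds -(automorphism_holds _ ga) [X in X <-> _]fH.
exact: iff_sym (automorphism_holds (f \o (g \o (fun i => \val (e (t i))))) h'a).
Qed.

(* Automorphisms that agree on [s] send the typeset over [s] to the same set, so
   this is empty or a single translate of it. *)
Definition coded_copy (s : seq T) (x : T) (k : nat) : set T :=
  [set v | exists g, [/\ automorphism U g, pickle (map g s) = k &
    (g @` typeset U [set` s] x) v]].

Lemma coded_copy_sub (s : seq T) (x : T) (k : nat) :
  exists2 h, automorphism U h & coded_copy s x k `<=` h @` typeset U [set` s] x.
Proof.
have [[v [h [ha hk _]]]|no] := pselect (exists v, coded_copy s x k v); last first.
  by exists id; [exact: automorphism_id | move=> v kv; case: no; exists v].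
exists h => // _ [g [ga gk [z Sz <-]]].
have [h' [h'a hK h'K]] := automorphism_inv ha.
exists (h' (g z)); last by rewrite h'K.
apply: (@typeset_stable _ _ _ _ _ (h' \o g)) => //.
split=> [|y /= sy]; first exact: automorphism_comp.
have gh : map g s = map h s.
  by apply: (pcan_inj pickleK); rewrite gk hk.
by have /eq_in_map/(_ _ sy) -> := gh; rewrite hK.
Qed.

(** By homogeneity [f] agrees on [s] and [z] with an automorphism. Its code depends only on [f] over
    [s], so a single copy receives the image of the whole typeset. *)
Lemma embedding_coded_copy (s : seq T) (x : T) (f : T -> T) : embedding U U f ->
  forall z, typeset U [set` s] x z -> coded_copy s x (pickle (map f s)) (f z).
Proof.
move=> [fI fH] z Sz.
have [|||g [ga gP]] :=
    @extend_partial_isomorphism _ _ U ([set` s] `|` [set z]) f homU.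
- by rewrite finite_setU; split; [exact: finite_seq | exact: finite_set1].
- by move=> a b _ _; exact: fI.
- by move=> r t _; exact: fH.
exists g; split=> //; last by exists z => //; rewrite gP //; right.
by congr pickle; apply/eq_in_map => y sy; rewrite gP //; left.
Qed.

End Copies.

Theorem theorem2p3 (L : language) (T : Type) (U : structure L T)
    (countableU : countable [set: T])
    (homogeneousU : homogeneous U)
    (free_ageU : free_amalgamation_class (age U))
    (not_rank_linearU : ~ rank_linear U) :
  ~ indivisible U.
Proof.
have [T' eT] := Pcountable countableU; subst T; move=> indivU.
apply: not_rank_linearU => F x F' x' Fx Fx'.
apply: contrapT => /not_orP[nFF' nF'F].
have [s Fs] : exists s : seq T', F = [set` s] by apply/finite_seqP; case: Fx.
have [s' Fs'] : exists s : seq T', F' = [set` s] by apply/finite_seqP; case: Fx'.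
subst F F'.
(* Ties go to [<s|x>]; a point in no copy from [<s|x>] falls in the other class. *)
pose first_copy v := exists2 k, coded_copy U s x k v &
  forall j, j < k -> ~ coded_copy U s' x' j v.
have [f [femb [[] fc]]] := indivU (fun v => `[< first_copy v >]).
  (* Colour [true]: images of the typeset of [<s'|x'>] lie in its copy of index [pickle (map f s')],
     hence also in copies from [<s|x>] of at most this index. *)
  apply: (@not_covered _ _ U homogeneousU [set` s] [set` s'] x x' f
    (coded_copy U s x) (pickle (map f s'))) => // [k|z Sz].
    exact: coded_copy_sub.
  have /asboolP[k kz nj] := fc z; exists k => //.
  rewrite leqNgt; apply/negP => /nj; apply.
  exact: embedding_coded_copy.
(* Colour [false]: the roles are exchanged, and the covering copies even have strictly smaller
   index. *)
apply: (@not_covered _ _ U homogeneousU [set` s'] [set` s] x' x f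
  (coded_copy U s' x') (pickle (map f s))) => // [k|z Sz].
  exact: coded_copy_sub.
apply: contrapT => no; have /asboolPn := negbT (fc z); apply.
exists (pickle (map f s)); first exact: embedding_coded_copy.
by move=> j jk jz; apply: no; exists j => //; exact: ltnW.
Qed.
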